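(* Suppose that $C$ is a chain complex of finitely generated $R$-modules with $C_n=0$ for $n<0$, such that $\mathbf BC=\mathrm{H}\text{-}o(n)$. Then the sequence $\mathbf HC$ is H-convergent (i.e., $C$ is pre-admissible) if and only if the sequence $\mathbf RC$ is H-convergent, in which case $$\chi_{\mathrm H}(C)=\mathrm{H}\text{-}\lim\mathbf HC=\mathrm{H}\text{-}\lim\mathbf RC .$$
   Context: $R$ is an arbitrary unital commutative Noetherian integral domain with field of fractions $Q$; $\mathbb{N}=\{1,2,3,\dots\}$. The rank of an $R$-module $A$ is $\mathrm{rank}\,A=\dim_Q(A\otimes_R Q)$. Let $M=(m_{i,j})_{i,j\in\mathbb{N}}$ be the Cesàro matrix: $m_{i,j}=1/i$ if $i\ge j$ and $m_{i,j}=0$ otherwise. A real sequence $\mathbf a=(a_n)_{n\in\mathbb{N}}$ is H-convergent if $M^k\mathbf a$ converges for some integer $k>0$; its H-limit $\mathrm{H}\text{-}\lim\mathbf a$ is $\lim M^k\mathbf a$ for sufficiently large $k$ (if $M^k\mathbf a$ converges then $M^m\mathbf a$ converges to the same limit for all $m\ge k$). An H-null sequence is an H-convergent sequence with H-limit $0$. We write $\mathbf a=\mathrm{H}\text{-}o(n)$ if $(a_n/n)_{n\in\mathbb{N}}$ is H-null. For a chain complex $C$ with boundary map $\partial$, put $\mathbf HC=\big((-1)^{n-1}\mathrm{rank}\,H_{n-1}C\big)_{n\in\mathbb{N}}$, $\mathbf BC=\big((-1)^{n-1}\mathrm{rank}\,B_{n-1}(C)\big)_{n\in\mathbb{N}}$,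 where $B_k(C)=\mathrm{im}(\partial\colon C_{k+1}\to C_k)$, and $\mathbf RC=\big((-1)^{n-1}\mathrm{rank}\,C_{n-1}\big)_{n\in\mathbb{N}}$. A chain complex $C$ of $R$-modules is pre-admissible if $C_n=0$ for $n<0$, all homology modules $H_nC$ are finitely generated, and $\mathbf HC$ is H-convergent; its infinite Euler characteristic is then $\chi_{\mathrm H}(C)=\mathrm{H}\text{-}\lim\mathbf HC$. *)

(* Defs.v *)
From HB Require Import structures.
From mathcomp Require Import all_boot all_order all_algebra.
From mathcomp Require Import freeg.
From mathcomp Require Import all_classical all_reals all_analysis.

Set Implicit Arguments.
Unset Strict Implicit.
Unset Printing Implicit Defensive.

Import Order.TTheory GRing.Theory Num.Theory.
Import numFieldNormedType.Exports.
Local Open Scope classical_set_scope.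
Local Open Scope ring_scope.
Local Open Scope quotient_scope.

(* Submodules are boolean predicates equipped with [submodClosed]; since every
   proposition is reflected by a boolean (`[< _ >]), they are all covered. *)

Section Submodule.
Variables (R : nzRingType) (V : lmodType R) (S : submodClosed V).

Definition submod : Type := {x : V | x \in S}.

HB.instance Definition _ := SubChoice.on submod.
HB.instance Definition _ := [SubChoice_isSubLmodule of submod by <:].

End Submodule.

Section QuotientModule.
Variables (R : nzRingType) (V : lmodType R) (S : submodClosed V).

(* [submodClosed] does not inherit from the [zmodClosed] required by
   [Quotient.quot] *)
Definition quotmod_pred : {pred V} := fun x => x \in S.

HB.instance Definition _ :=
  GRing.isSubmodClosed.Build R V quotmod_pred (GRing.subsemimodClosedP S).

Definition quotmod : Type := @Quotient.quot V quotmod_pred.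

HB.instance Definition _ := GRing.Zmodule.on quotmod.

Definition quotmod_pi (x : V) : quotmod := \pi_(@Quotient.quot V quotmod_pred) x.

Lemma quotmod_piP x y : quotmod_pi x = quotmod_pi y <-> x - y \in S.
Proof.
rewrite -[x - y \in S]/(x - y \in quotmod_pred).
rewrite (@Quotient.idealrBE V quotmod_pred).
by split=> /eqP.
Qed.

Lemma quotmod_pi_surj (u : quotmod) : exists x, u = quotmod_pi x.
Proof. by exists (repr (u : @Quotient.quot V quotmod_pred)); rewrite /quotmod_pi reprK. Qed.

Lemma quotmod_piB : {morph quotmod_pi : x y / x - y}.
Proof. exact: (raddfB \pi_(@Quotient.quot V quotmod_pred)). Qed.

HB.instance Definition _ :=
  GRing.isZmodMorphism.Build V quotmod quotmod_pi quotmod_piB.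

Definition quotmod_scale (a : R) (u : quotmod) : quotmod :=
  quotmod_pi (a *: repr (u : @Quotient.quot V quotmod_pred)).

Lemma quotmod_scale_pi a x :
  quotmod_scale a (quotmod_pi x) = quotmod_pi (a *: x).
Proof.
apply/quotmod_piP; rewrite -scalerBr rpredZ //.
by apply/quotmod_piP; rewrite /quotmod_pi reprK.
Qed.

Fact quotmod_scaleA a b u :
  quotmod_scale a (quotmod_scale b u) = quotmod_scale (a * b) u.
Proof.
by have [x ->] := quotmod_pi_surj u; rewrite !quotmod_scale_pi scalerA.
Qed.

Fact quotmod_scale1 : left_id 1 quotmod_scale.
Proof.
by move=> u; have [x ->] := quotmod_pi_surj u; rewrite quotmod_scale_pi scale1r.
Qed.

Fact quotmod_scaleDr : right_distributive quotmod_scale +%R.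
Proof.
move=> a u v; have [x ->] := quotmod_pi_surj u.
have [y ->] := quotmod_pi_surj v.
by rewrite -raddfD !quotmod_scale_pi scalerDr raddfD.
Qed.

Fact quotmod_scaleDl u : {morph quotmod_scale^~ u : a b / a + b}.
Proof.
move=> a b; have [x ->] := quotmod_pi_surj u.
by rewrite !quotmod_scale_pi scalerDl raddfD.
Qed.

HB.instance Definition _ := GRing.Zmodule_isLmodule.Build R quotmod
  quotmod_scaleA quotmod_scale1 quotmod_scaleDr quotmod_scaleDl.

Fact quotmod_pi_scalable : scalable quotmod_pi.
Proof. by move=> a x; rewrite -quotmod_scale_pi. Qed.

HB.instance Definition _ :=
  GRing.isScalable.Build R V quotmod *:%R quotmod_pi quotmod_pi_scalable.

End QuotientModule.

Section SubmoduleConstructions.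
Variables (R : nzRingType) (V W : lmodType R).

(* the smallest submodule containing G *)
Definition span_pred (G : set V) : {pred V} := fun x =>
  `[< forall S : submodClosed V, (forall g, G g -> g \in S) -> x \in S >].

Fact span_submod_closed (G : set V) : submod_closed (span_pred G).
Proof.
split=> [|a x y /asboolP Gx /asboolP Gy].
  by apply/asboolP => S _; exact: rpred0.
by apply/asboolP => S GS; rewrite rpredD ?rpredZ ?Gx ?Gy.
Qed.

HB.instance Definition _ (G : set V) :=
  GRing.isSubmodClosed.Build R V (span_pred G) (span_submod_closed G).

Definition kernel_pred (f : {linear V -> W}) : {pred V} := fun x => f x == 0.

Fact kernel_submod_closed (f : {linear V -> W}) :
  submod_closed (kernel_pred f).
Proof.
split=> [|a x y]; rewrite /kernel_pred !unfold_in ?linear0 ?eqxx//.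
by move=> /eqP fx /eqP fy; rewrite linearP fx fy scaler0 addr0.
Qed.

HB.instance Definition _ (f : {linear V -> W}) :=
  GRing.isSubmodClosed.Build R V (kernel_pred f) (kernel_submod_closed f).

Definition image_pred (f : {linear V -> W}) : {pred W} := fun y =>
  `[< exists x, f x = y >].

Fact image_submod_closed (f : {linear V -> W}) : submod_closed (image_pred f).
Proof.
split=> [|a _ _ /asboolP[x <-] /asboolP[y <-]].
  by apply/asboolP; exists 0; exact: linear0.
by apply/asboolP; exists (a *: x + y); exact: linearP.
Qed.

HB.instance Definition _ (f : {linear V -> W}) :=
  GRing.isSubmodClosed.Build R W (image_pred f) (image_submod_closed f).

Definition restrict_pred (S T : submodClosed V) : {pred submod S} := fun x =>
  val x \in T.

Arguments restrict_pred : clear implicits.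

Fact restrict_submod_closed (S T : submodClosed V) :
  submod_closed (restrict_pred S T).
Proof.
split=> [|a x y]; first exact: rpred0.
by move=> Tx Ty; rewrite unfold_in /restrict_pred linearP rpredD ?rpredZ.
Qed.

HB.instance Definition _ (S T : submodClosed V) :=
  GRing.isSubmodClosed.Build R (submod S) (restrict_pred S T)
    (restrict_submod_closed S T).

End SubmoduleConstructions.

Arguments restrict_pred {R V} S T.

Section FreeModule.
Variables (R : nzRingType) (K : choiceType) (M : lmodType R) (f : K -> M).

HB.instance Definition _ :=
  GRing.isZmodMorphism.Build {freeg K / R} M (fglift f) (lift_is_additive f).

Fact fglift_scalable : scalable (fglift f).
Proof.
move=> c D; have -> : c *: D = \sum_(x <- dom D) << c * coeff x D *g x >> by [].
rewrite -[in RHS](freeg_sumE D) !raddf_sum.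
by apply: eq_bigr => x _; rewrite /= !liftU scalerA.
Qed.

HB.instance Definition _ :=
  GRing.isScalable.Build R {freeg K / R} M *:%R (fglift f) fglift_scalable.

End FreeModule.

Section TensorProduct.
Variables (R : comNzRingType) (A B : lmodType R).

Local Notation F := {freeg (A * B)%type / R}.

Variant tensor_relator : set F :=
| TensorDl a a' b :
    tensor_relator (<< (a + a', b) >> - << (a, b) >> - << (a', b) >>)
| TensorDr a b b' :
    tensor_relator (<< (a, b + b') >> - << (a, b) >> - << (a, b') >>)
| TensorZl r a b : tensor_relator (<< (r *: a, b) >> - r *: << (a, b) >>)
| TensorZr r a b : tensor_relator (<< (a, r *: b) >> - r *: << (a, b) >>).

Definition tensor : Type := quotmod (span_pred tensor_relator).

HB.instance Definition _ := GRing.Lmodule.on tensor.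

Definition tensor_pi : F -> tensor := quotmod_pi (span_pred tensor_relator).

HB.instance Definition _ := GRing.Linear.on tensor_pi.

Lemma tensor_pi_surj (t : tensor) : exists D, t = tensor_pi D.
Proof. exact: quotmod_pi_surj. Qed.

Definition pure_tensor (a : A) (b : B) : tensor :=
  tensor_pi << (a, b) >>.

Lemma tensor_relator0 x :
  tensor_relator x -> tensor_pi x = 0.
Proof.
move=> rx; rewrite -(raddf0 (tensor_pi)).
apply/quotmod_piP; rewrite subr0.
by apply/asboolP => S; apply.
Qed.

Lemma pure_tensorDl b : {morph pure_tensor^~ b : a a' / a + a'}.
Proof.
move=> a a'; apply/eqP; rewrite -subr_eq0 opprD addrA -!raddfB.
exact/eqP/tensor_relator0/TensorDl.
Qed.

Lemma pure_tensorDr a : {morph pure_tensor a : b b' / b + b'}.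
Proof.
move=> b b'; apply/eqP; rewrite -subr_eq0 opprD addrA -!raddfB.
exact/eqP/tensor_relator0/TensorDr.
Qed.

Lemma pure_tensorZl r a b : pure_tensor (r *: a) b = r *: pure_tensor a b.
Proof.
apply/eqP; rewrite -subr_eq0 -linearZ -raddfB.
exact/eqP/tensor_relator0/TensorZl.
Qed.

Lemma pure_tensorZr r a b : pure_tensor a (r *: b) = r *: pure_tensor a b.
Proof.
apply/eqP; rewrite -subr_eq0 -linearZ -raddfB.
exact/eqP/tensor_relator0/TensorZr.
Qed.

Lemma tensor_sum_pure (t : tensor) :
  exists s : seq (A * B), t = \sum_(p <- s) pure_tensor p.1 p.2.
Proof.
have [D ->] := tensor_pi_surj t.
exists [seq (coeff p D *: p.1, p.2) | p <- dom D].
rewrite -{1}[D]freeg_sumE raddf_sum [RHS]big_map.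
apply: eq_bigr => -[a b] _ /=.
rewrite pure_tensorZl -linearZ; congr tensor_pi.
by apply/eqP/freeg_eqP => z; rewrite coeffZ !coeffU mul1r.
Qed.

Section Lift.
Variables (M : lmodType R) (f : A -> B -> M).

Definition tensor_lift (t : tensor) : M :=
  fglift (fun p => f p.1 p.2)
    (repr (t : @Quotient.quot F (quotmod_pred (span_pred tensor_relator)))).

Hypotheses (fl : forall b, linear (f^~ b)) (fr : forall a, linear (f a)).

Fact tensor_lift_pi (D : F) :
  tensor_lift (tensor_pi D) =
  fglift (fun p => f p.1 p.2) D.
Proof.
have fl0 b : f 0 b = 0.
  by have := fl b (-1) 0 0; rewrite scaler0 addr0 scaleN1r addNr.
have fr0 a : f a 0 = 0.
  by have := fr a (-1) 0 0; rewrite scaler0 addr0 scaleN1r addNr.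
pose g : {linear F -> M} := fglift (fun p => f p.1 p.2).
have gU a b : g << (a, b) >> = f a b by rewrite /g /= liftU scale1r.
apply/eqP; rewrite -subr_eq0 /tensor_lift -/(g _) -/(g D) -raddfB.
set x := _ - D.
have : x \in span_pred tensor_relator by apply/quotmod_piP; rewrite /tensor_pi /quotmod_pi reprK.
move=> /asboolP/(_ (kernel_pred g)); apply => _ [a a' b|a b b'|r a b|r a b];
  rewrite unfold_in /kernel_pred !raddfB/= ?linearZ/= !gU.
- by rewrite -{1}[a]scale1r fl scale1r -addrA -opprD subrr.
- by rewrite -{1}[b]scale1r fr scale1r -addrA -opprD subrr.
- by rewrite -[X in f X b]addr0 fl fl0 addr0 scalerN subrr.
- by rewrite -[X in f a X]addr0 fr fr0 addr0 scalerN subrr.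
Qed.

Lemma tensor_lift_pure a b : tensor_lift (pure_tensor a b) = f a b.
Proof. by rewrite tensor_lift_pi liftU scale1r. Qed.

Lemma tensor_lift_linear : linear tensor_lift.
Proof.
move=> r u v; have [x ->] := tensor_pi_surj u; have [y ->] := tensor_pi_surj v.
by rewrite -linearP !tensor_lift_pi linearP.
Qed.

End Lift.
End TensorProduct.

Section FractionModule.
Variable R : idomainType.

Definition frac_mod : Type := {fraction R}.

HB.instance Definition _ := GRing.Zmodule.on frac_mod.

Definition frac_mod_scale (r : R) (q : frac_mod) : frac_mod :=
  tofrac r * (q : {fraction R}).

Fact frac_mod_scaleA r s q :
  frac_mod_scale r (frac_mod_scale s q) = frac_mod_scale (r * s) q.
Proof. by rewrite /frac_mod_scale rmorphM mulrA. Qed.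

Fact frac_mod_scale1 : left_id 1 frac_mod_scale.
Proof. by move=> q; rewrite /frac_mod_scale rmorph1 mul1r. Qed.

Fact frac_mod_scaleDr : right_distributive frac_mod_scale +%R.
Proof. by move=> r p q; exact: mulrDr. Qed.

Fact frac_mod_scaleDl q : {morph frac_mod_scale^~ q : r s / r + s}.
Proof. by move=> r s; rewrite /frac_mod_scale rmorphD; exact: mulrDl. Qed.

HB.instance Definition _ := GRing.Zmodule_isLmodule.Build R frac_mod
  frac_mod_scaleA frac_mod_scale1 frac_mod_scaleDr frac_mod_scaleDl.

End FractionModule.

(* A \otimes_R Q, with the Q-vector space structure q (a \otimes p) =
   a \otimes (q p) *)
Section ExtensionOfScalars.
Variables (R : idomainType) (A : lmodType R).

Local Notation Q := {fraction R}.

Definition frac_tensor : Type := tensor A (frac_mod R).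

HB.instance Definition _ := GRing.Zmodule.on frac_tensor.

Definition frac_pure (a : A) (p : Q) : frac_tensor :=
  pure_tensor a (p : frac_mod R).

Definition frac_scale (q : Q) (t : frac_tensor) : frac_tensor :=
  tensor_lift (fun (a : A) (p : frac_mod R) =>
    pure_tensor a ((q * (p : Q)) : frac_mod R)) t.

Fact frac_scale_bilinear (q : Q) :
  let f := fun (a : A) (p : frac_mod R) =>
    pure_tensor a ((q * (p : Q)) : frac_mod R) in
  (forall p, linear (f^~ p)) /\ (forall a, linear (f a)).
Proof.
split=> [p r a a'|a r p p'] /=; first by rewrite pure_tensorDl pure_tensorZl.
rewrite -pure_tensorZr -pure_tensorDr; congr pure_tensor.
by rewrite [LHS]mulrDr; congr (_ + _); exact: mulrCA.
Qed.

Lemma frac_scale_pure q a p : frac_scale q (frac_pure a p) = frac_pure a (q * p).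
Proof. by have [fl fr] := frac_scale_bilinear q; exact: tensor_lift_pure. Qed.

Fact frac_scaleDr : right_distributive frac_scale +%R.
Proof.
move=> q t u; have [fl fr] := frac_scale_bilinear q.
by have := tensor_lift_linear fl fr 1 t u; rewrite !scale1r.
Qed.

Lemma frac_tensor_sum_pure (t : frac_tensor) :
  exists s : seq (A * Q), t = \sum_(p <- s) frac_pure p.1 p.2.
Proof. by have [s ->] := @tensor_sum_pure R A (frac_mod R) t; exists s. Qed.

Lemma frac_scale_sum q (s : seq (A * Q)) :
  frac_scale q (\sum_(p <- s) frac_pure p.1 p.2) =
  \sum_(p <- s) frac_pure p.1 (q * p.2).
Proof.
have q0 : frac_scale q 0 = 0.
  by apply: (addrI (frac_scale q 0)); rewrite -frac_scaleDr !addr0.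
rewrite (big_morph _ (frac_scaleDr q) q0).
by apply: eq_bigr => p _; exact: frac_scale_pure.
Qed.

Fact frac_scaleA p q t : frac_scale p (frac_scale q t) = frac_scale (p * q) t.
Proof.
have [s ->] := frac_tensor_sum_pure t; rewrite !frac_scale_sum.
have := frac_scale_sum p [seq (x.1, q * x.2) | x <- s]; rewrite !big_map /= => ->.
by apply: eq_bigr => x _; rewrite mulrA.
Qed.

Fact frac_scale1 : left_id 1 frac_scale.
Proof.
move=> t; have [s ->] := frac_tensor_sum_pure t; rewrite frac_scale_sum.
by apply: eq_bigr => x _; rewrite mul1r.
Qed.

Fact frac_scaleDl t : {morph frac_scale^~ t : p q / p + q}.
Proof.
move=> p q; have [s ->] := frac_tensor_sum_pure t; rewrite !frac_scale_sum.
rewrite -big_split; apply: eq_bigr => x _ /=.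
by rewrite mulrDl; exact: pure_tensorDr.
Qed.

HB.instance Definition _ := GRing.Zmodule_isLmodule.Build Q frac_tensor
  frac_scaleA frac_scale1 frac_scaleDr frac_scaleDl.

End ExtensionOfScalars.

Definition is_basis (F : fieldType) (V : lmodType F) n (b : 'I_n -> V) : Prop :=
  forall v, exists! c : 'rV[F]_n, v = \sum_(i < n) c 0 i *: b i.

(* 0 when V is infinite-dimensional *)
Definition vdim (F : fieldType) (V : lmodType F) : nat :=
  xget 0%N [set n | exists b : 'I_n -> V, is_basis b].

Definition rank (R : idomainType) (A : lmodType R) : nat := vdim (frac_tensor A).

Definition fin_gen (R : nzRingType) (A : lmodType R) : Prop :=
  exists n (g : 'I_n -> A),
    forall x, exists c : 'I_n -> R, x = \sum_(i < n) c i *: g i.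

Definition noetherian (R : comNzRingType) : Prop :=
  forall I : submodClosed R^o, fin_gen (submod I).

(* The boundary maps are given for all pairs of degrees, and vanish unless the
   degrees are consecutive; this avoids casts between C (n - 1 + 1) and C n. *)
Record chain_complex (R : nzRingType) := ChainComplex {
  chains :> int -> lmodType R;
  boundary : forall i j, {linear chains i -> chains j};
  boundary_shape : forall i j x, i != j + 1 -> boundary i j x = 0;
  boundary_comp : forall i j k x, boundary j k (boundary i j x) = 0
}.

Section Complex.
Variables (R : idomainType) (C : chain_complex R).

Definition cycles (n : int) : submodClosed (C n) :=
  kernel_pred (boundary C n (n - 1)).

Definition boundaries (n : int) : submodClosed (C n) :=
  image_pred (boundary C (n + 1) n).

Definition homology (n : int) := quotmod (restrict_pred (cycles n) (boundaries n)).

End Complex.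

(* A sequence (a_n) indexed by n = 1, 2, ... is the function on nat whose value
   at n is a_(n + 1); rows and columns of matrices are shifted likewise. *)
Section HConvergence.
Variable K : realType.
Implicit Types a : K^nat.

Definition cesaro_mx (i j : nat) : K := if (j <= i)%N then i.+1%:R^-1 else 0.

(* infinite matrix-vector product, row i of the matrix being 0 beyond column i *)
Definition cesaro_mul a : K^nat :=
  fun i => \sum_(j < i.+1) cesaro_mx i j * a j.

Lemma cesaro_mulE a : cesaro_mul a = arithmetic_mean a.
Proof.
apply/funext => i; rewrite /cesaro_mul /arithmetic_mean /= seriesEord/= mulr_sumr.
by apply: eq_bigr => j _; rewrite /cesaro_mx -ltnS ltn_ord.
Qed.

Definition Hcvg a : Prop :=
  exists2 k, (0 < k)%N & cvgn (iter k cesaro_mul a).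

Definition Hlim a : K :=
  xget 0 [set l | \forall k \near \oo, iter k cesaro_mul a @ \oo --> l].

Definition Hnull a : Prop := Hcvg a /\ Hlim a = 0.

Definition Ho_n a : Prop := Hnull (fun n => a n / n.+1%:R).

End HConvergence.

Section InfiniteEuler.
Variables (K : realType) (R : idomainType) (C : chain_complex R).

Definition HC : K^nat := fun n => (-1) ^+ n * (rank (homology C n))%:R.

Definition BC : K^nat := fun n => (-1) ^+ n * (rank (submod (boundaries C n)))%:R.

Definition RC : K^nat := fun n => (-1) ^+ n * (rank (C n))%:R.

Definition pre_admissible : Prop :=
  [/\ forall (n : int) (x : C n), n < 0 -> x = 0,
      forall n : int, fin_gen (homology C n) &
      Hcvg HC].

Definition Hchi : K := Hlim HC.

End InfiniteEuler.

(* Main.v *)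
(** Rank is additive on short exact sequences of finitely generated modules, so
    rank C_n = rank H_n + rank B_n + rank B_(n-1); with the alternating signs
    this reads RC = HC + D, where D is the backward difference of BC.  One
    Cesàro averaging telescopes D into the sequence BC_n / n, which is H-null
    by hypothesis; hence D is H-null, and HC and RC have the same H-limits.

    Additivity is proved without localizing: a linearly independent family b of
    A such that every element of A has a nonzero multiple in the span of b
    induces a Q-basis of the tensor product of A with Q, and such families can
    be concatenated along a short exact sequence. *)
Require Import Defs.
From HB Require Import structures.
From mathcomp Require Import all_boot all_order all_algebra.
From mathcomp Require Import all_classical all_reals all_analysis.
From mathcomp Require Import ring.

Set Implicit Arguments.
Unset Strict Implicit.
Unset Printing Implicit Defensive.

Import Order.TTheory GRing.Theory Num.Theory.
Import numFieldNormedType.Exports.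
Local Open Scope classical_set_scope.
Local Open Scope ring_scope.

(** * Concatenation of finite families *)

Section Concatenation.
Variables (T : Type) (m n : nat).

Definition fcat (f : 'I_m -> T) (g : 'I_n -> T) (k : 'I_(m + n)) : T :=
  match fintype.split k with inl i => f i | inr j => g j end.

Lemma fcat_lshift f g i : fcat f g (lshift n i) = f i.
Proof. by rewrite /fcat (unsplitK (inl i)). Qed.

Lemma fcat_rshift f g j : fcat f g (rshift m j) = g j.
Proof. by rewrite /fcat (unsplitK (inr j)). Qed.

Lemma fcat_ind (P : T -> Prop) f g :
  (forall i, P (f i)) -> (forall j, P (g j)) -> forall k, P (fcat f g k).
Proof. by rewrite /fcat => Pf Pg k; case: fintype.split. Qed.

End Concatenation.

(** * Finite generation of submodules over a Noetherian ring *)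

Section Spans.
Variables (R : nzRingType) (A : lmodType R).

(* [submodClosed] does not inherit from [zmodClosed], so that [rpredN] and
   [rpredB] do not apply. *)
Lemma submodN (S : submodClosed A) x : (- x \in S) = (x \in S).
Proof.
by apply/idP/idP=> /(rpredZ (-1)); rewrite scaleN1r ?opprK.
Qed.

Lemma submodB (S : submodClosed A) x y : x \in S -> y \in S -> x - y \in S.
Proof. by move=> Sx Sy; rewrite rpredD ?submodN. Qed.

Definition comb_pred n (g : 'I_n -> A) : {pred A} := fun x =>
  `[< exists c : 'I_n -> R, x = \sum_i c i *: g i >].

Lemma combP n (g : 'I_n -> A) x :
  reflect (exists c : 'I_n -> R, x = \sum_i c i *: g i) (x \in comb_pred g).
Proof. exact: asboolP. Qed.

Fact comb_submod_closed n (g : 'I_n -> A) : submod_closed (comb_pred g).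
Proof.
split=> [|a _ _ /combP[c ->] /combP[d ->]]; apply/combP.
  by exists (fun=> 0); rewrite big1 // => i _; rewrite scale0r.
exists (fun i => a * c i + d i); rewrite scaler_sumr -big_split.
by apply: eq_bigr => i _; rewrite /= scalerDl scalerA.
Qed.

HB.instance Definition _ n (g : 'I_n -> A) :=
  GRing.isSubmodClosed.Build R A (comb_pred g) (comb_submod_closed g).

Lemma sum_comb n (g : 'I_n -> A) (c : 'I_n -> R) :
  \sum_i c i *: g i \in comb_pred g.
Proof. by apply/combP; exists c. Qed.

Lemma comb_fcat m n (f : 'I_m -> A) (g : 'I_n -> A) x y :
  x \in comb_pred f -> y \in comb_pred g -> x + y \in comb_pred (fcat f g).
Proof.
move=> /combP[c ->] /combP[d ->]; apply/combP; exists (fcat c d).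
rewrite big_split_ord; congr (_ + _); apply: eq_bigr => i _.
  by rewrite !fcat_lshift.
by rewrite !fcat_rshift.
Qed.

Definition meet_pred (S T : submodClosed A) : {pred A} :=
  fun x => (x \in S) && (x \in T).

Fact meet_submod_closed (S T : submodClosed A) : submod_closed (meet_pred S T).
Proof.
split=> [|a x y /andP[Sx Tx] /andP[Sy Ty]]; apply/andP; first by rewrite !rpred0.
by rewrite !rpredD ?rpredZ.
Qed.

HB.instance Definition _ (S T : submodClosed A) :=
  GRing.isSubmodClosed.Build R A (meet_pred S T) (meet_submod_closed S T).

(* For [S] spanned by the last [n] of [n + 1] generators of [A] and [a] the
   first one, these are the leading coefficients of the elements of [N]. *)
Definition lead_pred (N S : submodClosed A) (a : A) : {pred R^o} :=
  fun r => `[< exists2 x, x \in N & x - r *: a \in S >].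

Fact lead_submod_closed N S a : submod_closed (lead_pred N S a).
Proof.
split=> [|r s t /asboolP[x Nx Sx] /asboolP[y Ny Sy]]; apply/asboolP.
  by exists 0; rewrite ?scale0r ?subr0 ?rpred0.
exists (r *: x + y); first by rewrite rpredD ?rpredZ.
have -> : r *: x + y - (r *: s + t) *: a = r *: (x - s *: a) + (y - t *: a).
  by rewrite scalerBr scalerDl scalerA opprD addrACA.
by rewrite rpredD ?rpredZ.
Qed.

HB.instance Definition _ N S a :=
  GRing.isSubmodClosed.Build R R^o (lead_pred N S a) (lead_submod_closed N S a).

End Spans.

(** Induction on the number of generators: the leading coefficients of [N] along the first generator
    form a finitely generated ideal. Elements of [N] realizing generators of that ideal, together
    with generators of the part of [N] inside the span of the other [g i], generate [N]. *)
Lemma noetherian_comb (R : comNzRingType) (A : lmodType R) n (g : 'I_n -> A)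
    (N : submodClosed A) : noetherian R ->
  {subset N <= comb_pred g} ->
  exists m (h : 'I_m -> A),
    (forall i, h i \in N) /\ {subset N <= comb_pred h}.
Proof.
move=> noethR; elim: n => [|n IHn] in g N *.
  by move=> Ng; exists 0%N, g; split=> // -[].
pose g0 := g ord0; pose g' := g \o lift ord0 => Ng.
have [|m [h [Nh hN]]] := IHn g' (meet_pred N (comb_pred g')).
  by move=> x /andP[].
have [k [u uI]] := noethR (lead_pred N (comb_pred g') g0).
have /choice[x /all_and2[Nx xu]] : forall i, exists x,
    x \in N /\ x - val (u i) *: g0 \in comb_pred g'.
  by move=> i; have /asboolP[x Nx xg] := valP (u i); exists x.
exists (k + m)%N, (fcat x h); split.
  by apply: (fcat_ind (P := fun z => z \in N)) => // j; have /andP[] := Nh j.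
move=> y Ny; have /combP[c yE] := Ng y Ny.
have Ic0 : c ord0 \in lead_pred N (comb_pred g') g0.
  apply/asboolP; exists y => //.
  by rewrite yE big_ord_recl addrC addKr; exact: (sum_comb g').
have [d] := uI (Sub (c ord0) Ic0).
move=> /(congr1 val); rewrite raddf_sum /= => c0E.
(* The sum has the same leading coefficient as [y], so the difference lies both in [N] and in the
   span of [g'], where [h] generates. *)
rewrite -[y](subrK (\sum_i d i *: x i)) addrC.
apply: comb_fcat; first exact: sum_comb.
apply: hN; apply/andP; split.
  by rewrite submodB ?rpred_sum// => i _; rewrite rpredZ.
rewrite yE big_ord_recl c0E scaler_suml addrAC -sumrB.
rewrite rpredD ?(sum_comb g')// rpred_sum// => i _.
by rewrite -[_ *: g ord0]scalerA -scalerBr rpredZ// -opprB submodN.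
Qed.

Lemma fin_gen_submod (R : comNzRingType) (A : lmodType R)
    (N : submodClosed A) : noetherian R -> fin_gen A -> fin_gen (submod N).
Proof.
move=> noethR [n [g gA]].
have [|m [h [Nh hN]]] := noetherian_comb noethR (g := g) (N := N).
  by move=> x _; apply/combP.
exists m, (fun i => Sub (h i) (Nh i)) => x.
have /combP[c xE] := hN _ (valP x).
exists c; apply: val_inj; rewrite xE raddf_sum.
by apply: eq_bigr.
Qed.

Lemma fin_gen_surj (R : nzRingType) (A B : lmodType R) (f : {linear A -> B}) :
  (forall y, exists x, f x = y) -> fin_gen A -> fin_gen B.
Proof.
move=> fsurj [n [g gA]]; exists n, (f \o g) => y.
have [x <-] := fsurj y; have [c ->] := gA x; exists c.
by rewrite linear_sum; apply: eq_bigr => i _; rewrite linearZ.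
Qed.

(** * Maximal independent families over a domain *)

Lemma add_fracZ (F : fieldType) (a c d r s : F) : r != 0 -> s != 0 ->
  (a * s * c + r * d) / (r * s) = a * (c / r) + d / s.
Proof. by move=> r0 s0; field; rewrite r0 s0. Qed.

Section Rank.
Variables (R : idomainType).
Implicit Types A : lmodType R.

Definition independent A n (b : 'I_n -> A) : Prop :=
  forall c : 'I_n -> R, \sum_i c i *: b i = 0 -> forall i, c i = 0.

(** Saturation of the span of [b]: the elements that are torsion modulo it. *)
Definition tspan_pred A n (b : 'I_n -> A) : {pred A} := fun x =>
  `[< exists2 r : R, r != 0 & r *: x \in comb_pred b >].

Fact tspan_submod_closed A n (b : 'I_n -> A) : submod_closed (tspan_pred b).
Proof.
split=> [|a x y /asboolP[r r0 xb] /asboolP[s s0 yb]]; apply/asboolP.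
  by exists 1; rewrite ?oner_eq0 ?scaler0 ?rpred0.
exists (r * s); first by rewrite mulf_neq0.
have -> : (r * s) *: (a *: x + y) = (s * a) *: (r *: x) + r *: (s *: y).
  by rewrite scalerDr !scalerA; congr (_ *: _ + _); ring.
by apply: rpredD; exact: rpredZ.
Qed.

HB.instance Definition _ A n (b : 'I_n -> A) :=
  GRing.isSubmodClosed.Build R A (tspan_pred b) (tspan_submod_closed b).

(** Over a domain this amounts to a maximal independent family. *)
Definition rbasis A n (b : 'I_n -> A) : Prop :=
  independent b /\ forall x, x \in tspan_pred b.

Lemma tspan_comb A n (b : 'I_n -> A) x : x \in comb_pred b -> x \in tspan_pred b.
Proof. by move=> xb; apply/asboolP; exists 1; rewrite ?oner_eq0 ?scale1r. Qed.

Lemma tspan_fcat A m n (b : 'I_m -> A) (d : 'I_n -> A) x y :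
  x \in tspan_pred b -> y \in tspan_pred d -> x + y \in tspan_pred (fcat b d).
Proof.
move=> /asboolP[r r0 rx] /asboolP[s s0 sy]; apply/asboolP.
exists (s * r); first by rewrite mulf_neq0.
rewrite scalerDr -scalerA [s * r]mulrC -scalerA.
by apply: comb_fcat; exact: rpredZ.
Qed.

Lemma tspanZ A n (b : 'I_n -> A) r x :
  r != 0 -> r *: x \in tspan_pred b -> x \in tspan_pred b.
Proof.
move=> r0 /asboolP[s s0]; rewrite scalerA => xb.
by apply/asboolP; exists (s * r); rewrite // mulf_neq0.
Qed.

(** Generators are treated one at a time: one already in the saturated span is dropped; any other
    can be prepended, since a relation with a nonzero coefficient on it would put it in that
    saturated span. *)
Lemma independent_tspan A n (g : 'I_n -> A) :
  exists m (b : 'I_m -> A),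
    independent b /\ forall i, g i \in tspan_pred b.
Proof.
elim: n g => [|n IHn] g; first by exists 0%N, g; split=> [c _ []|[]].
have [m [b [bfree bg]]] := IHn (g \o lift ord0).
have [g0b|g0b] := boolP (g ord0 \in tspan_pred b).
  by exists m, b; split=> // i; case: (unliftP ord0 i) => [j|] ->; rewrite ?bg.
pose b' := fcat (fun _ : 'I_1 => g ord0) b; exists (1 + m)%N, b'; split=> [c|i].
  rewrite /b' big_split_ord big_ord1 /= fcat_lshift.
  under eq_bigr do rewrite fcat_rshift.
  set c0 := c _ => c0E.
  have c00 : c0 = 0.
    apply: contraNeq g0b => c00; apply/asboolP; exists c0 => //.
    by move/eqP: c0E; rewrite addr_eq0 => /eqP ->; rewrite submodN sum_comb.
  move=> k; case: (split_ordP k) => j ->; first by rewrite ord1.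
  apply: (bfree (fun j => c (rshift 1 j))).
  by rewrite -[RHS]c0E c00 scale0r add0r.
case: (unliftP ord0 i) => [j|] ->.
  rewrite -[g _]add0r; apply: tspan_fcat; rewrite ?rpred0//; exact: bg.
rewrite -[g _]addr0; apply: tspan_fcat; rewrite ?rpred0//; apply: tspan_comb.
by apply/combP; exists (fun=> 1); rewrite big_ord1 scale1r.
Qed.

Lemma fin_gen_rbasis A : fin_gen A -> exists n (b : 'I_n -> A), rbasis b.
Proof.
move=> [n [g gA]]; have [m [b [bfree bg]]] := independent_tspan g.
exists m, b; split=> // x; have [c ->] := gA x.
by rewrite rpred_sum// => i _; rewrite rpredZ.
Qed.

(** For independence, [g] kills the part coming from [S], which isolates the coefficients of [d];
    injectivity of [f] handles the rest. For spanning, a nonzero multiple of [x] minus a combination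
    of [d] lies in the kernel of [g], hence comes from [S]. *)
Lemma rbasis_exact (S A T : lmodType R) (f : {linear S -> A})
    (g : {linear A -> T}) m (b : 'I_m -> S) n (d : 'I_n -> A) :
  injective f -> (forall x, g x = 0 <-> exists y, f y = x) ->
  rbasis b -> rbasis (g \o d) -> rbasis (fcat (f \o b) d).
Proof.
move=> finj fg [bfree bS] [dfree dT]; split=> [c|x].
  rewrite big_split_ord /=.
  under eq_bigr do rewrite fcat_lshift.
  under [X in _ + X]eq_bigr do rewrite fcat_rshift.
  under eq_bigr do rewrite -linearZ /=.
  rewrite -linear_sum /= => E.
  have cd j : c (rshift m j) = 0.
    apply: (dfree (fun j => c (rshift m j))).
    have /(congr1 g) := E; rewrite linear0 linearD /=.
    rewrite (proj2 (fg (f _))); last by eexists.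
    rewrite add0r linear_sum => gE; rewrite -[RHS]gE.
    by apply: eq_bigr => i _; rewrite linearZ.
  move: E; rewrite [X in _ + X]big1 => [|j _]; last by rewrite cd scale0r.
  rewrite addr0 -[RHS](linear0 f) => /finj E k.
  case: (split_ordP k) => j ->; last exact: cd.
  exact: (bfree (fun i => c (lshift n i))).
have /asboolP[r r0 /combP[c rx]] := dT (g x).
have /fg[y fy] : g (r *: x - \sum_i c i *: d i) = 0.
  rewrite linearB linearZ /= rx linear_sum /=; apply/eqP; rewrite subr_eq0.
  by apply/eqP/eq_bigr => i _; rewrite linearZ.
apply: (tspanZ r0).
rewrite -[r *: x](subrK (\sum_i c i *: d i)); apply: tspan_fcat.
  have /asboolP[s s0 /combP[c' sy]] := bS y.
  apply/asboolP; exists s => //; apply/combP; exists c'.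
  rewrite -fy -linearZ sy linear_sum.
  by apply: eq_bigr => i _; exact: linearZ.
exact/tspan_comb/sum_comb.
Qed.


Local Notation Q := {fraction R}.

(* The coordinates of [x] are the quotients [c i / r], for any relation
   [r *: x = \sum_i c i *: b i] with [r != 0]. *)
Lemma rbasis_coord A n (b : 'I_n -> A) : rbasis b ->
  exists phi : A -> 'I_n -> Q,
    (forall i, linear (fun x => phi x i : frac_mod R)) /\
    forall i j, phi (b j) i = (i == j)%:R.
Proof.
move=> [bfree bA].
have /choice[rc /all_and2[r0 rcE]] x : exists rc : R * ('I_n -> R),
    rc.1 != 0 /\ rc.1 *: x = \sum_i rc.2 i *: b i.
  by have /asboolP[r r0 /combP[c rx]] := bA x; exists (r, c).
pose phi x i : Q := tofrac ((rc x).2 i) / tofrac (rc x).1.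
have phiE x s c i : s != 0 -> s *: x = \sum_i c i *: b i ->
    phi x i = tofrac (c i) / tofrac s.
  move=> s0 sx; apply/eqP; rewrite eqr_div ?tofrac_eq0// -!tofracM tofrac_eq.
  rewrite -subr_eq0; apply/eqP.
  (* Cross-multiplying the two relations for [x] gives two expansions of one element, whose
     coefficients agree by independence. *)
  apply: (bfree (fun i => (rc x).2 i * s - c i * (rc x).1)).
  under eq_bigr do rewrite scalerBl [_ * s]mulrC [_ * (rc x).1]mulrC -!scalerA.
  by rewrite sumrB -!scaler_sumr -sx -rcE !scalerA mulrC subrr.
exists phi; split=> [i a x y|i j]; last first.
  rewrite (phiE _ 1 (fun k => (k == j)%:R)) ?oner_eq0//.
    by rewrite tofrac1 divr1 rmorph_nat.
  rewrite scale1r (bigD1 j)//= eqxx scale1r big1 ?addr0// => k /negPf ->.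
  by rewrite scale0r.
(* The product of the denominators chosen for [x] and [y] serves as a denominator for
   [a *: x + y]. *)
rewrite (phiE _ ((rc x).1 * (rc y).1)
  (fun i => a * (rc y).1 * (rc x).2 i + (rc x).1 * (rc y).2 i)) ?mulf_neq0//.
  change (tofrac (a * (rc y).1 * (rc x).2 i + (rc x).1 * (rc y).2 i) /
    tofrac ((rc x).1 * (rc y).1) = tofrac a * phi x i + phi y i :> Q).
  by rewrite tofracD !tofracM add_fracZ ?tofrac_eq0 ?r0.
rewrite scalerDr -scalerA [_ * (rc y).1]mulrC -[in X in _ + X]scalerA.
under eq_bigr do rewrite scalerDl -!scalerA.
rewrite big_split /= -!scaler_sumr -!rcE !scalerA; congr (_ *: _ + _ *: _).
  ring.
exact: mulrC.
Qed.

Lemma frac_pure_sum A (p : Q) (I : Type) (s : seq I) (F : I -> A) :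
  frac_pure (\sum_(i <- s) F i) p = \sum_(i <- s) frac_pure (F i) p.
Proof.
apply: (big_morph (fun a => frac_pure a p)) => [x y|].
  exact: (@pure_tensorDl R A (frac_mod R)).
apply: (addrI (frac_pure 0 p)); rewrite addr0.
by have := @pure_tensorDl R A (frac_mod R) p 0 0; rewrite addr0; exact: esym.
Qed.

Lemma frac_pureZ A (r : R) (x : A) (p : Q) :
  frac_pure (r *: x) p = frac_pure x (tofrac r * p).
Proof.
rewrite /frac_pure (@pure_tensorZl R A (frac_mod R)).
by rewrite -(@pure_tensorZr R A (frac_mod R)).
Qed.

(** Spanning comes from clearing denominators: x ⊗ p = (r x) ⊗ (p / r), with [r *: x] in the span of
    [b]. Uniqueness comes from coordinate forms on the tensor product that extend those of
    [rbasis_coord]. *)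
Lemma rbasis_is_basis A n (b : 'I_n -> A) : rbasis b ->
  is_basis (fun i => frac_pure (b i) 1).
Proof.
move=> bA; have [phi [philin phib]] := rbasis_coord bA.
have [bfree bspan] := bA.
set e := fun i => _.
have pureE i p : frac_pure (b i) p = p *: e i.
  by rewrite -[RHS]/(frac_scale _ _) frac_scale_pure mulr1.
have espan v : v \in comb_pred e.
  have [s ->] := frac_tensor_sum_pure v; apply: rpred_sum => -[x p] _ /=.
  have /asboolP[r r0 /combP[c rx]] := bspan x.
  have r0' : tofrac r != 0 by rewrite tofrac_eq0.
  rewrite -[p](mulVKf r0') -frac_pureZ rx frac_pure_sum.
  apply: rpred_sum => i _; rewrite frac_pureZ pureE rpredZ//.
  apply/combP; exists (fun k => (k == i)%:R).
  rewrite (bigD1 i)//= eqxx scale1r big1 ?addr0// => k /negPf ->.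
  by rewrite scale0r.
(* By the universal property, this bilinear map induces the coordinate form [T j]. *)
pose f j (a : A) (p : frac_mod R) : frac_mod R := (p : Q) * phi a j.
have fl j p : linear ((f j)^~ p).
  move=> a x y; rewrite /f (philin j) -[a *: _ in RHS]/(tofrac a * _).
  by rewrite -[a *: _]/(tofrac a * _) mulrDr mulrCA.
have fr j x : linear (f j x).
  move=> a p q; rewrite /f -[a *: p]/(tofrac a * _).
  by rewrite -[a *: _]/(tofrac a * _) mulrDl mulrA.
pose T j (t : frac_tensor A) : Q := tensor_lift (f j) t.
have TD j : {morph T j : t u / t + u}.
  by move=> t u; have := tensor_lift_linear (fl j) (fr j) 1 t u; rewrite !scale1r.
have T0 j : T j 0 = 0 by apply: (addrI (T j 0)); rewrite -TD !addr0.
have Te j c : T j (\sum_i c i *: e i) = c j.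
  rewrite (big_morph _ (TD j) (T0 j)) (bigD1 j)//= big1 => [|i ij].
    rewrite addr0 -pureE /T /frac_pure (tensor_lift_pure (fl j) (fr j)).
    by rewrite /f phib eqxx mulr1.
  rewrite -pureE /T /frac_pure (tensor_lift_pure (fl j) (fr j)).
  by rewrite /f phib eq_sym (negPf ij) mulr0.
move=> v; have /combP[c vE] := espan v; exists (\row_i c i); split.
  by rewrite vE; apply: eq_bigr => i _; rewrite mxE.
move=> d dE; apply/rowP => j; rewrite mxE.
by rewrite -(Te j c) -vE dE (Te j (fun i => d 0 i)).
Qed.

End Rank.

(** * Invariance of dimension and additivity of rank *)

Lemma is_basis_leq (F : fieldType) (V : lmodType F) m n
    (b : 'I_m -> V) (d : 'I_n -> V) : is_basis b -> is_basis d -> (m <= n)%N.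
Proof.
move=> bV dV.
have /choice[P PE] i : exists p : 'rV_n, b i = \sum_j p 0 j *: d j.
  by have [p [pE _]] := dV (b i); exists p.
have /choice[S SE] j : exists s : 'rV_m, d j = \sum_i s 0 i *: b i.
  by have [s [sE _]] := bV (d j); exists s.
(* The product of the two change-of-basis matrices is the identity of size [m] and factors through
   dimension [n], which forces [m <= n]. *)
suff : (\matrix_i P i) *m (\matrix_j S j) = 1%:M by apply: mulmx1_min.
apply/row_matrixP => i; have [c [_ cuniq]] := bV (b i).
(* Both rows are coordinate vectors of [b i] in the basis [b], so they coincide by uniqueness. *)
rewrite -[LHS]cuniq -?[RHS]cuniq//.
  rewrite [LHS](_ : _ = \sum_k (k == i)%:R *: b k); last first.
    rewrite (bigD1 i)//= eqxx scale1r big1 ?addr0// => k /negPf ->.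
    by rewrite scale0r.
  by apply: eq_bigr => k _; rewrite !mxE eq_sym.
rewrite [LHS]PE; under eq_bigr do rewrite SE scaler_sumr.
rewrite exchange_big; apply: eq_bigr => k _ /=.
under eq_bigr do rewrite scalerA.
rewrite -scaler_suml; congr (_ *: _); rewrite !mxE.
by apply: eq_bigr => j _; rewrite !mxE.
Qed.

Lemma vdim_basis (F : fieldType) (V : lmodType F) n (b : 'I_n -> V) :
  is_basis b -> vdim V = n.
Proof.
move=> bV; apply: xget_unique => [|m [d dV]]; first by exists b.
by apply/anti_leq; rewrite (is_basis_leq bV dV) (is_basis_leq dV bV).
Qed.

Lemma rank_rbasis (R : idomainType) (A : lmodType R) n (b : 'I_n -> A) :
  rbasis b -> rank A = n.
Proof. by move=> /rbasis_is_basis; apply: vdim_basis. Qed.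

(** An [rbasis] of [T] lifts along [g] and, joined to the image of an [rbasis] of [S], gives one of
    [A]. *)
Lemma rank_exact (R : idomainType) (S A T : lmodType R)
    (f : {linear S -> A}) (g : {linear A -> T}) :
  fin_gen S -> fin_gen T -> injective f ->
  (forall x, g x = 0 <-> exists y, f y = x) -> (forall z, exists x, g x = z) ->
  rank A = (rank S + rank T)%N.
Proof.
move=> /fin_gen_rbasis[m [b bS]] /fin_gen_rbasis[n [d dT]] finj fg gsurj.
have /choice[d' d'E] i := gsurj (d i).
have gd : g \o d' = d by apply/funext => i; rewrite /= d'E.
rewrite (rank_rbasis bS) (rank_rbasis dT).
have dT' : rbasis (g \o d') by rewrite gd.
exact: rank_rbasis (rbasis_exact finj fg bS dT').
Qed.

(** * Exact sequences of cycles, boundaries and homology *)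

Section SubmoduleMaps.
Variables (R : nzRingType) (V W : lmodType R).

Definition corestr (f : {linear V -> W}) (x : V) : submod (image_pred f) :=
  Sub (f x) (asboolT (ex_intro _ x erefl)).

Fact corestr_linear f : linear (corestr f).
Proof. by move=> a x y; apply: val_inj; rewrite [RHS]linearP; exact: linearP. Qed.

HB.instance Definition _ f :=
  GRing.isLinear.Build R V (submod (image_pred f)) *:%R (corestr f)
    (corestr_linear f).

Variables (S T : submodClosed V) (sST : {subset S <= T}).

Definition submod_incl (x : submod S) : submod T := Sub (val x) (sST (valP x)).

Fact submod_incl_linear : linear submod_incl.
Proof. by move=> a x y; apply: val_inj; rewrite [RHS]linearP; exact: linearP. Qed.

HB.instance Definition _ :=
  GRing.isLinear.Build R (submod S) (submod T) *:%R submod_incl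
    submod_incl_linear.

End SubmoduleMaps.

Section ComplexRanks.
Variables (R : idomainType) (C : chain_complex R).
Hypotheses (noethR : noetherian R) (fgC : forall n : int, fin_gen (C n)).

(** For a variable degree, [m + 1 - 1] is not convertible to [m]; taking the equation as a
    hypothesis transports the kernel condition without casts between chain modules. *)
Lemma cyclesP (n m : int) (x : C n) :
  n = m + 1 -> x \in cycles C n <-> boundary C n m x = 0.
Proof. by move=> nm; have -> : m = n - 1; [rewrite nm addrK | split=> /eqP]. Qed.

Lemma fin_gen_homology (n : int) : fin_gen (homology C n).
Proof.
apply: (fin_gen_surj (f := quotmod_pi _)); last exact: fin_gen_submod.
by move=> u; have [x ->] := quotmod_pi_surj u; exists x.
Qed.

(** From the exact sequence 0 -> Z_(n+1) -> C_(n+1) -> B_n -> 0. *)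
Lemma rank_chains (n : int) :
  rank (C (n + 1)) =
  (rank (submod (cycles C (n + 1))) + rank (submod (boundaries C n)))%N.
Proof.
apply: (rank_exact (f := val : {linear submod (cycles C (n + 1)) -> _})
  (g := corestr (boundary C (n + 1) n))).
- exact: fin_gen_submod.
- exact: fin_gen_submod.
- exact: val_inj.
- move=> x; split=> [/(congr1 val) /= bx0|[z <-]].
    have xZ : x \in cycles C (n + 1) by apply/(cyclesP _ erefl).
    by exists (Sub x xZ).
  by apply: val_inj; apply/(cyclesP _ erefl)/(valP z).
- move=> z; have /asboolP[x xz] := valP z.
  by exists x; apply: val_inj.
Qed.

(** From the exact sequence 0 -> B_n -> Z_n -> H_n -> 0. *)
Lemma rank_cycles (n : int) :
  rank (submod (cycles C n)) =
  (rank (submod (boundaries C n)) + rank (homology C n))%N.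
Proof.
have BZ : {subset boundaries C n <= cycles C n}.
  by move=> _ /asboolP[x <-]; apply/eqP/boundary_comp.
apply: (rank_exact (f := submod_incl BZ) (g := quotmod_pi _)).
- exact: fin_gen_submod.
- exact: fin_gen_homology.
- by move=> x y /(congr1 val) xy; apply: val_inj.
- move=> x; rewrite -(linear0 (quotmod_pi _)); split.
    move=> /quotmod_piP; rewrite subr0 => xB.
    by exists (Sub (val x) xB); apply: val_inj.
  move=> [y <-]; apply/quotmod_piP; rewrite subr0; exact: (valP y).
- by move=> u; have [x ->] := quotmod_pi_surj u; exists x.
Qed.

(** Meant for degree -1; the empty family is an [rbasis] of the zero module. *)
Lemma rank_boundaries_eq0 (n : int) :
  (forall x : C n, x = 0) -> rank (submod (boundaries C n)) = 0%N.
Proof.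
move=> C0; apply: (@rank_rbasis _ _ 0%N (fun=> 0)); split=> [c _ []//|x].
rewrite (_ : x = 0) ?rpred0//; apply: val_inj; exact: C0.
Qed.

End ComplexRanks.

(** * H-limits and iterated Cesàro averaging *)

Section HLimits.
Variable K : realType.
Implicit Types (a b : K^nat) (l : K).

(** The relation underlying [Hlim]; it avoids the default value 0 that [Hlim] takes on sequences
    without an H-limit. *)
Definition is_Hlim a l : Prop :=
  \forall k \near \oo, iter k (@cesaro_mul K) a @ \oo --> l.

Lemma cesaro_mul_cvg a l : a @ \oo --> l -> cesaro_mul a @ \oo --> l.
Proof. by rewrite cesaro_mulE; exact: cesaro. Qed.

(** Averaging preserves ordinary limits, so convergence at one stage persists at all later ones. *)
Lemma iter_is_Hlim k a l : iter k (@cesaro_mul K) a @ \oo --> l -> is_Hlim a l.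
Proof.
move=> al; exists k => // m /= /subnK <-.
by elim: (m - k)%N => //= i; exact: cesaro_mul_cvg.
Qed.

Lemma is_Hlim_unique a l : is_Hlim a l -> Hlim a = l.
Proof.
move=> al; apply: xget_unique => // m am; near \oo => k.
apply: (@cvg_unique K^o (@norm_hausdorff _ _) (iter k (@cesaro_mul K) a @ \oo)).
  by near: k.
by near: k.
Unshelve. all: by end_near. Qed.

Lemma HcvgP a : Hcvg a <-> is_Hlim a (Hlim a).
Proof.
split=> [[k _ /cvg_ex[l /iter_is_Hlim al]]|[k _ ak]].
  by rewrite (is_Hlim_unique al).
(* [Hcvg] asks for a positive number of averagings, while the threshold [k] may be 0. *)
by exists k.+1 => //; apply/cvg_ex; exists (Hlim a); apply: ak; rewrite /= leqnSn.
Qed.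

Lemma cesaro_mul_comb c a b :
  cesaro_mul (fun n => a n + c * b n) =
  (fun n => cesaro_mul a n + c * cesaro_mul b n).
Proof.
apply/funext => i; rewrite /cesaro_mul mulr_sumr -big_split.
by apply: eq_bigr => j _; rewrite /= mulrDr mulrCA.
Qed.

(** Iterated averaging is linear, and beyond a common stage both iterates converge. *)
Lemma is_Hlim_comb c a b l m : is_Hlim a l -> is_Hlim b m ->
  is_Hlim (fun n => a n + c * b n) (l + c * m).
Proof.
have iterE k : iter k (@cesaro_mul K) (fun n => a n + c * b n) =
    (fun n => iter k (@cesaro_mul K) a n + c * iter k (@cesaro_mul K) b n).
  by elim: k => //= k ->; rewrite cesaro_mul_comb.
move=> al bm; rewrite /is_Hlim; near=> k; rewrite iterE; apply: cvgD.
  by near: k.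
by apply: cvgMr; near: k.
Unshelve. all: by end_near. Qed.

(** One extra averaging only shifts the stage of convergence. *)
Lemma cesaro_mul_is_Hlim a l : is_Hlim (cesaro_mul a) l -> is_Hlim a l.
Proof.
move=> [k _ ak]; apply: (@iter_is_Hlim k.+1); rewrite iterSr.
exact: ak (leqnn k).
Qed.

(** The value before index 0 is taken to be 0, in agreement with the vanishing of the boundaries in
    degree -1. *)
Definition backward_diff a : K^nat :=
  fun n => a n - (if n is m.+1 then a m else 0).

Lemma sum_backward_diff a n : \sum_(j < n.+1) backward_diff a j = a n.
Proof.
elim: n => [|n IHn]; first by rewrite big_ord1 /backward_diff subr0.
by rewrite big_ord_recr /= IHn /backward_diff addrC subrK.
Qed.

Lemma cesaro_mul_backward_diff a :
  cesaro_mul (backward_diff a) = (fun n => a n / n.+1%:R).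
Proof.
apply/funext => n; rewrite /cesaro_mul -[in RHS](sum_backward_diff a n) mulr_suml.
by apply: eq_bigr => j _; rewrite /cesaro_mx -ltnS ltn_ord mulrC.
Qed.

Lemma Ho_n_backward_diff a : Ho_n a -> is_Hlim (backward_diff a) 0.
Proof.
move=> [/HcvgP al a0]; apply: cesaro_mul_is_Hlim.
by rewrite cesaro_mul_backward_diff -a0.
Qed.

End HLimits.

(** * Comparison of the chain and homology sequences *)

Lemma RC_HC (K : realType) (R : idomainType) (C : chain_complex R) :
  noetherian R -> (forall n : int, fin_gen (C n)) ->
  (forall x : C (-1), x = 0) ->
  RC K C = (fun n => HC K C n + backward_diff (BC K C) n).
Proof.
move=> noethR fgC C0; apply/funext => n; rewrite /RC /HC /BC /backward_diff /=.
case: n => [|n].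
  (* In degree 0 the exact sequence ends in B_(-1), of rank 0 because C_(-1) vanishes; this matches
     the initial term of [backward_diff]. *)
  have e0 : Posz 0 = -1 + 1 by [].
  rewrite [X in rank (C X)]e0 rank_chains// rank_boundaries_eq0// -e0.
  by rewrite rank_cycles// !expr0 !mul1r subr0 addn0 natrD addrC.
have nE : Posz n.+1 = Posz n + 1 by rewrite -addn1 PoszD.
rewrite [X in rank (C X)]nE rank_chains// -nE rank_cycles// !natrD exprS.
by ring.
Qed.

Unset Implicit Arguments.

Theorem theorem7p1 (K : realType) (R : idomainType) (C : chain_complex R) :
  noetherian R ->
  (forall n : int, fin_gen (C n)) ->
  (forall (n : int) (x : C n), n < 0 -> x = 0) ->
  Ho_n (BC K C) ->
  [/\ Hcvg (HC K C) <-> pre_admissible K C,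
      Hcvg (HC K C) <-> Hcvg (RC K C) &
      Hcvg (HC K C) ->
        Hchi K C = Hlim (HC K C) /\ Hlim (HC K C) = Hlim (RC K C)].
Proof.
move=> noethR fgC C0 /Ho_n_backward_diff B0.
have RE := RC_HC K noethR fgC (fun x => C0 _ x isT).
(* Adding or subtracting the H-null difference turns one sequence into the other, so every H-limit
   of one is an H-limit of the other. *)
have HR l : is_Hlim (HC K C) l <-> is_Hlim (RC K C) l.
  split=> [/(is_Hlim_comb 1)/(_ B0)|/(is_Hlim_comb (-1))/(_ B0)];
    rewrite mulr0 addr0 RE; congr is_Hlim; apply/funext => n.
    by rewrite mul1r.
  by rewrite mulN1r addrK.
split; last by move=> /HcvgP/HR/is_Hlim_unique ->.
  (* The conditions of pre-admissibility other than H-convergence follow from the assumptions on [R]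
     and [C]. *)
  by split=> [HCcvg|[]//]; split=> // n; exact: fin_gen_homology.
split=> /HcvgP/HR al; apply/HcvgP; first by rewrite (is_Hlim_unique al).
by rewrite (is_Hlim_unique al).
Qed.
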